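(* Let $L$ and $M$ be Lie algebras over $K$, with $L$ acting by derivations on $M$. Suppose that $\lambda:G\to\operatorname{End}_0(L)$ and $\pi:G\to\operatorname{End}_0(M)$ are ideal partial representations such that $(\pi,M)$ is a covariant representation of $\lambda$. Then the actions $\Lambda(\lambda\times\pi)$ of $G$ on $\Lambda(L\ltimes M)$ and $\Lambda(\lambda)\times\Lambda(\pi)$ of $G$ on $\Lambda(L)\ltimes\Lambda(M)$ are isomorphic (via a $G$-equivariant Lie algebra isomorphism). In particular, $$\Lambda(L\ltimes M)\cong\Lambda(L)\ltimes\Lambda(M).$$
   Context: $K$ is an associative commutative unital ring, all modules, algebras and tensor products are over $K$, and $G$ is a group. Products in Lie algebras are denoted by $\cdot$. $\operatorname{End}_0(L)$ is the monoid of Lie algebra endomorphisms of $L$. A partial representation of $G$ in a monoid $S$ is a map $\pi:G\to S$ with $\pi_1=1_S$, $\pi_{g^{-1}}\pi_g\pi_h=\pi_{g^{-1}}\pi_{gh}$ and $\pi_g\pi_h\pi_{h^{-1}}=\pi_{gh}\pi_{h^{-1}}$ for all $g,h\in G$. An ideal partial representation of $G$ on an algebra $A$ is a partial representation $\lambda:G\to\operatorname{End}_0(A)$ with each $\operatorname{im}\lambda_g$ a two-sided ideal. $L$ acts by derivations on $M$ if there is a $K$-bilinear map $L\times M\to M$, $(x,m)\mapsto xm$, with $(x\cdot y)m=x(ym)-y(xm)$ and $x(m\cdot n)=(xm)\cdot n+m\cdot(xn)$. The semidirect product $L\ltimes M$ is the Lie algebra on $L\times M$ with $(x,m)\cdot(y,n)=(x\cdot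 y,\,m\cdot n+xn-ym)$. $(\pi,M)$ is a covariant representation of $\lambda$ if for all $g\in G,x\in L,m\in M$: (1) $\pi_g(xm)=\lambda_g(x)\pi_g(m)$; (2) $\varepsilon_g(xm)=e_g(x)m=x\varepsilon_g(m)$, where $\varepsilon_g=\pi_g\pi_{g^{-1}}$, $e_g=\lambda_g\lambda_{g^{-1}}$. For a Lie algebra $A$ with ideal partial representation $\rho$ of $G$, $\Lambda(A)$ is the quotient of the $K$-module $KG\otimes A$ by the submodule generated by all $g\otimes\rho_h(a)-gh\otimes a$ ($g,h\in G$, $a\in\operatorname{im}\rho_{h^{-1}}$); $\lfloor g,a\rfloor$ is the class of $g\otimes a$. It is a Lie algebra with product $\lfloor g,a\rfloor\cdot\lfloor h,b\rfloor=\lfloor g,a\cdot\rho_{g^{-1}h}(b)\rfloor$, with the global $G$-action $\Lambda(\rho)_g(\lfloor h,a\rfloor)=\lfloor gh,a\rfloor$ by Lie algebra automorphisms. $\Lambda(L)$, $\Lambda(M)$ and $\Lambda(L\ltimes M)$ are formed with $\lambda$, $\pi$ and $\lambda\times\pi$, respectively, where $(\lambda\times\pi)_g(x,m)=(\lambda_g(x),\pi_g(m))$ is an ideal partial representation of $G$ on $L\ltimes M$. $\Lambda(L)$ acts by derivations on $\Lambda(M)$ via $\lfloor g,x\rfloor\lfloor h,m\rfloor=\lfloor g,x\,\pi_{g^{-1}h}(m)\rfloor$, which defines $\Lambda(L)\ltimes\Lambda(M)$, and $(\Lambda(\lambda)\times\Lambda(\pi))_g(u,v)=(\Lambda(\lambda)_g(u),\Lambda(\pi)_g(v))$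 is a global $G$-action on it by Lie algebra automorphisms. *)

(* Defs.v *)
From HB Require Import structures.
From mathcomp Require Import all_boot all_order all_algebra finmap ssrAC.
From mathcomp Require Import boolp classical_sets functions cardinality fsbigop.

Set Implicit Arguments.
Unset Strict Implicit.
Unset Printing Implicit Defensive.

Import GRing.Theory.

Local Open Scope classical_set_scope.
Local Open Scope ring_scope.

Lemma linear_ex (K : pzRingType) (U V : lmodType K) (f : U -> V) :
  linear f -> exists g : {linear U -> V}, g =1 f.
Proof.
by move=> lf; exists (HB.pack_for {linear U -> V} f (GRing.isLinear.Build K U V _ f lf)).
Qed.

Section Span.
Variables (K : comPzRingType) (V : lmodType K).

Definition submodule (W : set V) : Prop :=
  W 0 /\ forall (a : K) u v, W u -> W v -> W (a *: u + v).

Definition span (S : set V) : pred V :=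
  fun v => `[< forall W : set V, submodule W -> S `<=` W -> W v >].

Lemma span_submod (S : set V) : GRing.submod_closed (span S).
Proof.
split=> [|a u v]; first by apply/asboolP => W [].
move=> /asboolP Su /asboolP Sv; apply/asboolP => W sW SW.
by apply: sW.2; [apply: Su | apply: Sv].
Qed.

HB.instance Definition _ (S : set V) :=
  GRing.isSubmodClosed.Build K V (span S) (span_submod S).

Lemma sub_span (S : set V) v : S v -> v \in span S.
Proof. by move=> Sv; apply/asboolP => W _; apply. Qed.

End Span.

Section LinearFunctions.
Variables (K : comPzRingType) (U V N : lmodType K).

Lemma linear_comb c (f g : V -> N) : linear f -> linear g -> linear (c *: f + g).
Proof.
move=> lf lg d u v; rewrite -[LHS]/(c *: f (d *: u + v) + g (d *: u + v)) lf lg.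
rewrite -[RHS]/(d *: (c *: f u + g u) + (c *: f v + g v)).
by rewrite !scalerDr !scalerA [c * d]mulrC addrACA.
Qed.

Lemma linear_fun_submod (F : U -> V -> N) :
  linear F -> submodule [set u | linear (F u)].
Proof.
move=> lF; have [F' F'E] := linear_ex lF.
split=> /= [|c x y lx ly]; last by rewrite lF; apply: linear_comb.
by rewrite -F'E linear0 => d u v; rewrite [RHS]addr0 [RHS]scaler0.
Qed.

Lemma linear_eq_submod (f g : V -> N) :
  linear f -> linear g -> submodule [set u | f u = g u].
Proof.
move=> /linear_ex [f' f'E] /linear_ex [g' g'E].
split=> [|c u v] /=; first by rewrite -f'E -g'E !linear0.
by rewrite -!f'E -!g'E !linearP => -> ->.
Qed.

End LinearFunctions.

Section QuotientModule.
Variables (K : comPzRingType) (V : lmodType K) (S : set V).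

(* V modulo the submodule generated by S; ring_quotient only provides the
   abelian group structure. *)
Definition span_closed : zmodClosed V := GRing.ZmodClosed.clone V (span S) _.

Definition quotmod : Type := Quotient.quot span_closed.

HB.instance Definition _ := GRing.Zmodule.on quotmod.

Definition quotpi (v : V) : quotmod := \pi_(Quotient.quot span_closed)%qT v.

Lemma quotpi_eq u v : (quotpi u = quotpi v) <-> (u - v \in span S).
Proof. by rewrite Quotient.idealrBE; split=> /eqP. Qed.

Lemma quotpi_surj (x : quotmod) : exists v, x = quotpi v.
Proof. by exists (repr x); rewrite /quotpi reprK. Qed.

Lemma quotpiB u v : quotpi (u - v) = quotpi u - quotpi v.
Proof. exact: raddfB. Qed.

Lemma quotpiD u v : quotpi (u + v) = quotpi u + quotpi v.
Proof. exact: raddfD. Qed.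

Definition quotmod_scale (a : K) (x : quotmod) : quotmod := quotpi (a *: repr x).

Lemma quotpi_scale a v : quotmod_scale a (quotpi v) = quotpi (a *: v).
Proof.
apply/quotpi_eq; rewrite -scalerBr; apply: rpredZ.
by apply/quotpi_eq; rewrite /quotpi reprK.
Qed.

Fact quotmod_scaleA a b x :
  quotmod_scale a (quotmod_scale b x) = quotmod_scale (a * b) x.
Proof. by have [v ->] := quotpi_surj x; rewrite !quotpi_scale scalerA. Qed.

Fact quotmod_scale1 : left_id 1 quotmod_scale.
Proof. by move=> x; have [v ->] := quotpi_surj x; rewrite quotpi_scale scale1r. Qed.

Fact quotmod_scaleDr : right_distributive quotmod_scale +%R.
Proof.
move=> a x y; have [u ->] := quotpi_surj x; have [v ->] := quotpi_surj y.
by rewrite -quotpiD !quotpi_scale scalerDr quotpiD.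
Qed.

Fact quotmod_scaleDl x : {morph quotmod_scale^~ x : a b / a + b}.
Proof.
by move=> a b; have [v ->] := quotpi_surj x; rewrite !quotpi_scale scalerDl quotpiD.
Qed.

HB.instance Definition _ := GRing.Zmodule_isLmodule.Build K quotmod
  quotmod_scaleA quotmod_scale1 quotmod_scaleDr quotmod_scaleDl.

Fact quotpi_linear : linear quotpi.
Proof. by move=> a u v; rewrite quotpiD -quotpi_scale. Qed.

HB.instance Definition _ := GRing.isLinear.Build K V quotmod _ quotpi quotpi_linear.

Lemma quotmod_univ (N : lmodType K) (f : V -> N) :
    linear f -> (forall v, S v -> f v = 0) ->
  exists F : quotmod -> N, linear F /\ forall v, F (quotpi v) = f v.
Proof.
move=> /linear_ex [f' f'E] fS.
have kerf v : v \in span S -> f' v = 0.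
  move=> /asboolP /(_ [set v | f' v = 0]); apply.
  by split=> [|a u w /= u0 w0]; rewrite /= ?linear0 // linearP u0 w0 scaler0 addr0.
  by move=> w /fS; rewrite -f'E.
have Fpi v : f' (repr (quotpi v)) = f' v.
  apply/subr0_eq; rewrite -linearB; apply: kerf; apply/quotpi_eq.
  by rewrite /quotpi reprK.
exists (fun x => f' (repr x)); split=> [a x y|v]; last by rewrite Fpi f'E.
have [u ->] := quotpi_surj x; have [v ->] := quotpi_surj y.
by rewrite -linearP !Fpi linearP.
Qed.

End QuotientModule.

Section FreeModule.
Variables (K : comPzRingType) (X : choiceType).

Definition finsupp : pred (X -> K^o) :=
  fun f => `[< finite_set [set x | f x != 0] >].

Fact finsupp_submod : GRing.submod_closed finsupp.
Proof.
split=> [|a u v]; first by apply/asboolP; rewrite (_ : mkset _ = set0) //;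
  apply/seteqP; split=> x //=; rewrite eqxx.
move=> /asboolP Su /asboolP Sv; apply/asboolP.
apply: (@sub_finite_set _ _ ([set x | u x != 0] `|` [set x | v x != 0])).
  move=> x /=; have [u0|] := eqVneq (u x) 0; last by left.
  have [v0|] := eqVneq (v x) 0; last by right.
  by rewrite [X in X != 0](_ : _ = 0) ?eqxx // -[LHS]/(a *: u x + v x) u0 v0
    scaler0 addr0.
by rewrite finite_setU.
Qed.

HB.instance Definition _ :=
  GRing.isSubmodClosed.Build K (X -> K^o) finsupp finsupp_submod.

(* The free K-module on X: finitely supported functions. *)
Record freemod := Freemod { freemod_val :> X -> K^o; _ : finsupp freemod_val }.

HB.instance Definition _ := [isSub for freemod_val].
HB.instance Definition _ := [Choice of freemod by <:].
HB.instance Definition _ := [SubChoice_isSubLmodule of freemod by <:].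

Fact delta_subproof (x : X) : finsupp (fun y => (y == x)%:R).
Proof.
apply/asboolP; apply: (@sub_finite_set _ _ [set x]); last exact: finite_set1.
by move=> y /=; case: (y =P x) => //; rewrite eqxx.
Qed.

Definition fdelta (x : X) : freemod := Freemod (delta_subproof x).

Lemma freemodE (f : freemod) (S : {fset X}) :
    (forall x, x \notin S -> f x = 0) -> f = \sum_(x <- S) f x *: fdelta x.
Proof.
move=> fS; apply: val_inj; rewrite raddf_sum /=; apply/funext => y.
rewrite fct_sumE; have [yS|yS] := boolP (y \in S).
  rewrite (big_fsetD1 y) //= big1_fset ?addr0.
    by rewrite -[RHS]/(f y * (y == y)%:R) eqxx mulr1.
  move=> x /fsetD1P [xy _] _; rewrite -[LHS]/(f x * (y == x)%:R).
  by rewrite eq_sym (negPf xy) mulr0.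
rewrite fS // big1_fset // => x xS _; rewrite -[LHS]/(f x * (y == x)%:R).
by case: eqP yS => [->|_]; rewrite ?xS ?mulr0.
Qed.

Lemma freemod_supp (f : freemod) : exists S : {fset X}, forall x, x \notin S -> f x = 0.
Proof.
have /asboolP /finite_fsetP [S eS] := valP f.
exists S => x; apply: contraNeq => fx.
by have : [set x | f x != 0] x by []; rewrite eS.
Qed.

Lemma freemod_ind (P : set freemod) :
  submodule P -> (forall x, P (fdelta x)) -> forall f, P f.
Proof.
move=> [P0 PP] Pd f; have [S /freemodE ->] := freemod_supp f.
by elim/big_ind: _ => // [u v Pu Pv|x _]; [rewrite -[u]scale1r | rewrite -[_ *: _]addr0];
  apply: PP.
Qed.

Lemma freemod_univ (N : lmodType K) (phi : X -> N) :
  exists F : freemod -> N, linear F /\ forall x, F (fdelta x) = phi x.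
Proof.
pose F (f : freemod) := \sum_(x \in [set: X]) (f x *: phi x).
have FE (f : freemod) (S : {fset X}) : (forall x, x \notin S -> f x = 0) ->
    F f = \sum_(x <- S) f x *: phi x.
  by move=> fS; rewrite /F (fsbigTE S) // => x /fS ->; rewrite scale0r.
exists F; split=> [a f g|x].
  have [S fS] := freemod_supp f; have [T gT] := freemod_supp g.
  have fST x : x \notin (S `|` T)%fset -> f x = 0.
    by rewrite inE negb_or => /andP [/fS].
  have gST x : x \notin (S `|` T)%fset -> g x = 0.
    by rewrite inE negb_or => /andP [_ /gT].
  have afgE x : (a *: f + g) x = a * f x + g x by [].
  have afgST x : x \notin (S `|` T)%fset -> (a *: f + g) x = 0.
    by move=> xST; rewrite afgE fST // gST // mulr0 addr0.
  rewrite (FE f _ fST) (FE g _ gST) (FE _ _ afgST) scaler_sumr -big_split /=.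
  by apply: eq_bigr => x _; rewrite scalerA -scalerDl.
have eF y : fdelta x y = (y == x)%:R by [].
rewrite (FE _ [fset x]%fset) => [|y]; first by rewrite big_seq_fset1 eF eqxx scale1r.
by rewrite inE eF => /negPf ->.
Qed.

End FreeModule.

Section TensorProduct.
Variables (K : comPzRingType) (U V : lmodType K).

Definition bilinear_map (N : lmodType K) (f : U -> V -> N) : Prop :=
  (forall v, linear (f^~ v)) /\ (forall u, linear (f u)).

Definition tensor_rel : set (freemod K (U * V)%type) := [set r |
  (exists a u1 u2 v, r = fdelta K (a *: u1 + u2, v)
                         - (a *: fdelta K (u1, v) + fdelta K (u2, v))) \/
  (exists a u v1 v2, r = fdelta K (u, a *: v1 + v2)
                         - (a *: fdelta K (u, v1) + fdelta K (u, v2)))].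

Definition tensor : Type := quotmod tensor_rel.

HB.instance Definition _ := GRing.Lmodule.on tensor.

Definition tens (u : U) (v : V) : tensor := quotpi tensor_rel (fdelta K (u, v)).

Lemma tens_bilinear : bilinear_map tens.
Proof.
split=> [v a u1 u2|u a v1 v2]; rewrite /tens -linearP; apply/quotpi_eq;
  apply: sub_span; [left | right].
- by exists a, u1, u2, v.
- by exists a, u, v1, v2.
Qed.

Lemma tensor_ind (P : set tensor) :
  submodule P -> (forall u v, P (tens u v)) -> forall t, P t.
Proof.
move=> [P0 PP] Pt t; have [f ->] := quotpi_surj t.
apply: (@freemod_ind _ _ [set f | P (quotpi _ f)]) => [|[u v]]; last exact: Pt.
by split=> /= [|a u v Pu Pv]; rewrite ?linear0 // linearP; apply: PP.
Qed.

Lemma tensor_univ (N : lmodType K) (phi : U -> V -> N) : bilinear_map phi ->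
  exists F : tensor -> N, linear F /\ forall u v, F (tens u v) = phi u v.
Proof.
move=> [phil phir].
have [f [lf fE]] := freemod_univ (fun p : U * V => phi p.1 p.2).
have [f' f'f] := linear_ex lf.
have f'E x : f' (fdelta K x) = phi x.1 x.2 by rewrite f'f fE.
have [|F [lF FE]] := @quotmod_univ _ _ tensor_rel N f' (linearP f').
  move=> r [] [a [? [? [? ->]]]];
    by rewrite linearB [f' (_ *: _ + _)]linearP !f'E /= (phil, phir) subrr.
by exists F; split=> // u v; rewrite FE f'E.
Qed.

End TensorProduct.

HB.mixin Record Lmodule_isLie (K : comPzRingType) L of GRing.Lmodule K L := {
  lieb : L -> L -> L;
  lieb_bilinear : bilinear_map lieb;
  liebb : forall x, lieb x x = 0;
  lieb_jacobi : forall x y z,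
    lieb x (lieb y z) + lieb y (lieb z x) + lieb z (lieb x y) = 0
}.

#[short(type="lieAlgType")]
HB.structure Definition LieAlgebra (K : comPzRingType) :=
  {L of GRing.Lmodule K L & Lmodule_isLie K L}.

Notation "x ⋅ y" := (lieb x y) (at level 40, left associativity) : ring_scope.

Section BilinearTheory.
Variables (K : comPzRingType) (U V N : lmodType K) (f : U -> V -> N).
Hypothesis bf : bilinear_map f.

Lemma bilDl v : {morph f^~ v : x y / x + y}.
Proof. by move=> x y; have := bf.1 v 1 x y; rewrite !scale1r. Qed.

Lemma bilDr u : {morph f u : x y / x + y}.
Proof. by move=> x y; have := bf.2 u 1 x y; rewrite !scale1r. Qed.

Lemma bil0l v : f 0 v = 0.
Proof. by apply: (addrI (f 0 v)); rewrite -bilDl !addr0. Qed.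

Lemma bil0r u : f u 0 = 0.
Proof. by apply: (addrI (f u 0)); rewrite -bilDr !addr0. Qed.

Lemma bilZl a u v : f (a *: u) v = a *: f u v.
Proof. by have := bf.1 v a u 0; rewrite bil0l !addr0. Qed.

Lemma bilZr a u v : f u (a *: v) = a *: f u v.
Proof. by have := bf.2 u a v 0; rewrite bil0r !addr0. Qed.

Lemma bilNl u v : f (- u) v = - f u v.
Proof. by rewrite -scaleN1r bilZl scaleN1r. Qed.

Lemma bilNr u v : f u (- v) = - f u v.
Proof. by rewrite -scaleN1r bilZr scaleN1r. Qed.

Lemma bilBl u1 u2 v : f (u1 - u2) v = f u1 v - f u2 v.
Proof. by rewrite bilDl bilNl. Qed.

Lemma bilBr u v1 v2 : f u (v1 - v2) = f u v1 - f u v2.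
Proof. by rewrite bilDr bilNr. Qed.

End BilinearTheory.

Section LieTheory.
Variables (K : comPzRingType) (L : lieAlgType K).
Implicit Types x y z : L.

Let lb : bilinear_map (@lieb K L) := lieb_bilinear.

Lemma liebDl y : {morph (@lieb K L)^~ y : u v / u + v}. Proof. exact: bilDl. Qed.
Lemma liebDr x : {morph @lieb K L x : u v / u + v}. Proof. exact: bilDr. Qed.
Lemma liebZl a x y : (a *: x) ⋅ y = a *: (x ⋅ y). Proof. exact: bilZl. Qed.
Lemma liebZr a x y : x ⋅ (a *: y) = a *: (x ⋅ y). Proof. exact: bilZr. Qed.
Lemma liebNl x y : (- x) ⋅ y = - (x ⋅ y). Proof. exact: bilNl. Qed.
Lemma liebNr x y : x ⋅ (- y) = - (x ⋅ y). Proof. exact: bilNr. Qed.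
Lemma lieb0l y : 0 ⋅ y = 0 :> L. Proof. exact: bil0l. Qed.
Lemma lieb0r x : x ⋅ 0 = 0. Proof. exact: bil0r. Qed.

Lemma liebC x y : x ⋅ y = - (y ⋅ x).
Proof.
by apply/eqP; rewrite -addr_eq0 -(liebb (x + y)) liebDl !liebDr !liebb addr0 add0r.
Qed.

Lemma lieb_leibniz x y z : x ⋅ (y ⋅ z) = (x ⋅ y) ⋅ z + y ⋅ (x ⋅ z).
Proof.
apply/subr0_eq; rewrite opprD [(x ⋅ y) ⋅ z]liebC opprK [x ⋅ z]liebC liebNr opprK.
by rewrite [z ⋅ _ + _]addrC addrA lieb_jacobi.
Qed.

End LieTheory.

Section LieHom.
Variables (K : comPzRingType) (L M : lieAlgType K).

Record lie_hom := LieHom {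
  lie_hom_fun :> L -> M;
  lie_hom_linear : linear lie_hom_fun;
  lie_homM : {morph lie_hom_fun : x y / x ⋅ y} }.

HB.instance Definition _ (f : lie_hom) :=
  GRing.isLinear.Build K L M _ f (lie_hom_linear f).

HB.instance Definition _ := gen_eqMixin lie_hom.
HB.instance Definition _ := gen_choiceMixin lie_hom.

Lemma lie_homP (f g : lie_hom) : f =1 g -> f = g.
Proof.
case: f g => [f lf mf] [g lg mg] /= /funext fg; rewrite -{}fg in lg mg *.
by congr LieHom; apply: Prop_irrelevance.
Qed.

End LieHom.

(* End_0(L), a monoid under composition. *)
Definition lie_end (K : comPzRingType) (L : lieAlgType K) : Type := lie_hom L L.

Section LieEndMonoid.
Variables (K : comPzRingType) (L : lieAlgType K).

Definition lie_end_one : lie_end L :=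
  @LieHom K L L idfun (fun a u v => erefl) (fun x y => erefl).

Fact lie_end_comp_linear (f g : lie_end L) : linear (f \o g).
Proof. by move=> a u v; rewrite /= !linearP. Qed.

Fact lie_end_compM (f g : lie_end L) : {morph f \o g : x y / x ⋅ y}.
Proof. by move=> x y; rewrite /= !lie_homM. Qed.

Definition lie_end_comp (f g : lie_end L) : lie_end L :=
  LieHom (lie_end_comp_linear f g) (lie_end_compM f g).

Fact lie_end_compA : associative lie_end_comp.
Proof. by move=> f g h; apply: lie_homP. Qed.

Fact lie_end_comp1f : left_id lie_end_one lie_end_comp.
Proof. by move=> f; apply: lie_homP. Qed.

Fact lie_end_compf1 : right_id lie_end_one lie_end_comp.
Proof. by move=> f; apply: lie_homP. Qed.

HB.instance Definition _ := Choice.on (lie_end L).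
HB.instance Definition _ := isMonoid.Build (lie_end L)
  lie_end_compA lie_end_comp1f lie_end_compf1.

End LieEndMonoid.

Section PartialRepresentations.

Definition partial_rep (G : groupType) (S : monoidType) (pi : G -> S) : Prop :=
  [/\ pi 1 = 1,
      forall g h, pi g^-1 * pi g * pi h = pi g^-1 * pi (g * h)
    & forall g h, pi g * pi h * pi h^-1 = pi (g * h) * pi h^-1]%g.

Variables (K : comPzRingType).

Definition two_sided_ideal (A : lieAlgType K) (I : set A) : Prop :=
  submodule I /\ forall a x, I x -> I (a ⋅ x) /\ I (x ⋅ a).

Record ideal_prep (G : groupType) (A : lieAlgType K) := IdealPrep {
  iprep_fun :> G -> lie_end A;
  iprepP : partial_rep iprep_fun;
  iprep_ideal : forall g, two_sided_ideal (range (iprep_fun g)) }.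

(* The map of g^-1 inverts that of g in End_0(A), so these are actions by Lie
   algebra automorphisms. *)
Record global_action (G : groupType) (A : lieAlgType K) := GlobalAction {
  gact_fun :> G -> lie_end A;
  gact1 : (gact_fun 1 = 1)%g;
  gactM : (forall g h, gact_fun (g * h) = gact_fun g * gact_fun h)%g }.

Definition lie_iso (A B : lieAlgType K) : Prop :=
  exists f : lie_hom A B, bijective f.

Definition action_iso (G : groupType) (A B : lieAlgType K)
    (alpha : global_action G A) (beta : global_action G B) : Prop :=
  exists f : lie_hom A B,
    bijective f /\ forall g x, f (alpha g x) = beta g (f x).

End PartialRepresentations.

Section IdealPrepTheory.
Variables (K : comPzRingType) (G : groupType) (A : lieAlgType K).
Variable rho : ideal_prep G A.

Lemma iprep1 a : rho 1%g a = a.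
Proof. by have [-> _ _] := iprepP rho. Qed.

Lemma iprepVgM g h a :
  rho g^-1%g (rho g (rho h a)) = rho g^-1%g (rho (g * h)%g a).
Proof.
have [_ /(_ g h) e _] := iprepP rho.
by have := congr1 (fun f : lie_end A => f a) e.
Qed.

Lemma iprepMgV g h a :
  rho g (rho h (rho h^-1%g a)) = rho (g * h)%g (rho h^-1%g a).
Proof.
have [_ _ /(_ g h) e] := iprepP rho.
by have := congr1 (fun f : lie_end A => f a) e.
Qed.

Lemma iprep_rng g h a :
  range (rho h^-1%g) a -> rho g (rho h a) = rho (g * h)%g a.
Proof. by move=> [b _ <-]; exact: iprepMgV. Qed.

Lemma iprep_idem g a : range (rho g) a -> rho g (rho g^-1%g a) = a.
Proof.
move=> [b _ <-]; have := iprepVgM g^-1%g g b.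
by rewrite invgK mulVg iprep1.
Qed.

Lemma iprep_idealr g a b : range (rho g) a -> range (rho g) (a ⋅ b).
Proof. by move=> ra; have [_ /(_ b a ra) []] := iprep_ideal rho g. Qed.

Lemma iprep_ideall g a b : range (rho g) a -> range (rho g) (b ⋅ a).
Proof. by move=> ra; have [_ /(_ b a ra) []] := iprep_ideal rho g. Qed.

Lemma iprep_mulr g a b :
  range (rho g) a -> a ⋅ rho g (rho g^-1%g b) = a ⋅ b.
Proof.
move=> ra; rewrite -[RHS](iprep_idem (iprep_idealr b ra)) 2!lie_homM.
by rewrite (iprep_idem ra).
Qed.

Lemma iprep_mull g a b :
  range (rho g) a -> rho g (rho g^-1%g b) ⋅ a = b ⋅ a.
Proof. by move=> ra; rewrite liebC iprep_mulr // -liebC. Qed.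

Lemma iprep_shift g h k a b :
  rho (g^-1 * h)%g (a ⋅ rho (h^-1 * k)%g b) =
  rho (g^-1 * h)%g a ⋅ rho (g^-1 * k)%g b.
Proof.
rewrite lie_homM.
have -> : (h^-1 * k = (g^-1 * h)^-1 * (g^-1 * k))%g.
  by rewrite invgM invgK -mulgA mulVKg.
have := iprepVgM (g^-1 * h)^-1%g (g^-1 * k)%g b; rewrite invgK => <-.
by rewrite iprep_mulr //; exists a.
Qed.

End IdealPrepTheory.

Section Lambda.
Variables (K : comPzRingType) (G : groupType) (A : lieAlgType K).
Variable rho : ideal_prep G A.

(* As a K-module, KG is free on G. *)
Definition Lambda_rel : set (tensor (freemod K G) A) := [set r |
  exists g h a, range (rho h^-1%g) a /\
    r = tens (fdelta K g) (rho h a) - tens (fdelta K (g * h)%g) a].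

Definition Lambda : Type := quotmod Lambda_rel.

HB.instance Definition _ := GRing.Lmodule.on Lambda.

Definition Lclass (g : G) (a : A) : Lambda :=
  quotpi Lambda_rel (tens (fdelta K g) a).

Lemma Lclass_linear g : linear (Lclass g).
Proof. by move=> c a b; rewrite /Lclass (tens_bilinear _ _).2 linearP. Qed.

Lemma Lclass_rel g h a :
  range (rho h^-1%g) a -> Lclass g (rho h a) = Lclass (g * h)%g a.
Proof. by move=> ra; apply/quotpi_eq; apply: sub_span; exists g, h, a. Qed.

Lemma Lambda_ind (P : set Lambda) :
  submodule P -> (forall g a, P (Lclass g a)) -> forall u, P u.
Proof.
move=> [P0 PP] Pc u; have [t ->] := quotpi_surj u.
apply: (@tensor_ind _ _ _ [set t | P (quotpi _ t)]) => [|f a] /=.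
  by split=> /= [|c x y Px Py]; rewrite ?linear0 // linearP; apply: PP.
apply: (@freemod_ind _ _ [set f | P (quotpi _ (tens f a))]) => [|g]; last exact: Pc.
have [tl _] := @tens_bilinear _ (freemod K G) A.
split=> /= [|c x y Px Py]; first by rewrite (bil0l (@tens_bilinear _ _ _)) linear0.
by rewrite tl linearP; apply: PP.
Qed.

Lemma Lambda_univ (N : lmodType K) (phi : G -> A -> N) :
    (forall g, linear (phi g)) ->
    (forall g h a, range (rho h^-1%g) a -> phi g (rho h a) = phi (g * h)%g a) ->
  exists F : Lambda -> N, linear F /\ forall g a, F (Lclass g a) = phi g a.
Proof.
move=> lphi phiE; have [psi [lpsi psiE]] := @freemod_univ K G (A -> N : lmodType K) phi.
have bpsi : bilinear_map psi.
  split=> [a c x y|f]; first by rewrite lpsi.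
  apply: (@freemod_ind _ _ [set f | linear (psi f)]) => [|g]; last by rewrite /= psiE.
  exact: linear_fun_submod.
have [F [lF FE]] := tensor_univ bpsi.
have [F' F'E] := linear_ex lF.
have [|H [lH HE]] := @quotmod_univ _ _ Lambda_rel N F' (linearP F').
  move=> r [g [h [a [ra ->]]]]; rewrite linearB !F'E !FE !psiE.
  by rewrite phiE // subrr.
by exists H; split=> // g a; rewrite HE F'E FE psiE.
Qed.

End Lambda.

Notation "⌊ g , a ⌋[ rho ]" := (Lclass rho g a)
  (format "⌊ g ,  a ⌋[ rho ]") : ring_scope.

Section LambdaPairing.
Variables (K : comPzRingType) (G : groupType) (A B : lieAlgType K).
Variables (rho : ideal_prep G A) (sigma : ideal_prep G B) (act : A -> B -> B).
Hypothesis act_bil : bilinear_map act.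
Hypothesis act_eqv : forall g a b, sigma g (act a b) = act (rho g a) (sigma g b).
Hypothesis act_rng : forall g a b, range (rho g) a -> range (sigma g) (act a b).
Hypothesis act_idem : forall g a b,
  range (rho g) a -> act a (sigma g (sigma g^-1%g b)) = act a b.

Lemma Lambda_pairing : exists F : Lambda rho -> Lambda sigma -> Lambda sigma,
  bilinear_map F /\
  forall g a h b, F ⌊g, a⌋[rho] ⌊h, b⌋[sigma] = ⌊g, act a (sigma (g^-1 * h)%g b)⌋[sigma].
Proof.
have ex1 (p : G * A) : exists F : Lambda sigma -> Lambda sigma, linear F /\
    forall h b, F ⌊h, b⌋[sigma] = ⌊p.1, act p.2 (sigma (p.1^-1 * h)%g b)⌋[sigma].
  apply: Lambda_univ => [h c x y|h k b rb].
    by rewrite linearP act_bil.2 Lclass_linear.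
  by rewrite (iprep_rng _ rb) mulgA.
have [m mP] := choice ex1.
have [lm mE] : (forall p, linear (m p)) /\ forall g a h b,
    m (g, a) ⌊h, b⌋[sigma] = ⌊g, act a (sigma (g^-1 * h)%g b)⌋[sigma].
  by split=> [p|g a h b]; [have [] := mP p | have [_ ->] := mP (g, a)].
have [|g h a ra|F [lF FE]] := @Lambda_univ _ _ _ rho
    (Lambda sigma -> Lambda sigma : lmodType K) (fun g a => m (g, a)).
- move=> g c x y; apply/funext; apply: Lambda_ind => [|h b].
    apply: linear_eq_submod; first exact: lm.
    exact: linear_comb (lm _) (lm _).
  rewrite -[RHS]/(c *: m (g, x) ⌊h, b⌋[sigma] + m (g, y) ⌊h, b⌋[sigma]).
  by rewrite !mE act_bil.1 Lclass_linear.
- apply/funext; apply: Lambda_ind => [|k b]; first by apply: linear_eq_submod; apply: lm.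
  have ra' : range (rho h) (rho h a) by exists a.
  rewrite !mE -Lclass_rel ?act_eqv; last exact: act_rng.
  have -> : ((g * h)^-1 * k = h^-1 * (g^-1 * k))%g by rewrite invgM mulgA.
  rewrite -[sigma h _]/(sigma h _).
  have := iprepVgM sigma h^-1%g (g^-1 * k)%g b; rewrite invgK => <-.
  by rewrite act_idem.
- exists F; split; last by move=> g a h b; rewrite FE mE.
  split=> [v c x y|]; first by rewrite lF.
  apply: Lambda_ind => [|g a]; last by rewrite /= FE; apply: lm.
  exact: linear_fun_submod.
Qed.

End LambdaPairing.

Section LambdaLie.
Variables (K : comPzRingType) (G : groupType) (A : lieAlgType K).
Variable rho : ideal_prep G A.

Fact Lambda_lieb_ex : exists F : Lambda rho -> Lambda rho -> Lambda rho,
  bilinear_map F /\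
  forall g a h b, F ⌊g, a⌋[rho] ⌊h, b⌋[rho] = ⌊g, a ⋅ rho (g^-1 * h)%g b⌋[rho].
Proof.
apply: Lambda_pairing.
- exact: lieb_bilinear.
- by move=> g a b; rewrite lie_homM.
- by move=> g a b; apply: iprep_idealr.
- by move=> g a b; apply: iprep_mulr.
Qed.

(* Determined by Lambda_lieb_class, since the classes span (Lambda_ind); likewise
   for Lambda_act and Lambda_der_fun. *)
Definition Lambda_lieb := sval (cid Lambda_lieb_ex).

Lemma Lambda_lieb_bilinear : bilinear_map Lambda_lieb.
Proof. exact: (svalP (cid Lambda_lieb_ex)).1. Qed.

Lemma Lambda_lieb_class g a h b :
  Lambda_lieb ⌊g, a⌋[rho] ⌊h, b⌋[rho] = ⌊g, a ⋅ rho (g^-1 * h)%g b⌋[rho].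
Proof. exact: (svalP (cid Lambda_lieb_ex)).2. Qed.

Let bb := Lambda_lieb_bilinear.

Lemma Lclass_linear_ex g :
  exists f : {linear A -> Lambda rho}, forall a, ⌊g, a⌋[rho] = f a.
Proof. by have [f fE] := linear_ex (Lclass_linear rho g); exists f => a. Qed.

Fact Lambda_liebC u v : Lambda_lieb u v = - Lambda_lieb v u.
Proof.
move: u; apply: Lambda_ind => [|g a].
  split=> /= [|c x y]; first by rewrite (bil0l bb) (bil0r bb) oppr0.
  by rewrite (bilDl bb) (bilZl bb) (bilDr bb) (bilZr bb) => -> ->;
    rewrite opprD scalerN.
move: v; apply: Lambda_ind => [|h b].
  split=> /= [|c x y]; first by rewrite (bil0l bb) (bil0r bb) oppr0.
  by rewrite (bilDl bb) (bilZl bb) (bilDr bb) (bilZr bb) => -> ->;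
    rewrite opprD scalerN.
rewrite /= !Lambda_lieb_class; have [f fE] := Lclass_linear_ex h.
rewrite [in RHS]fE -linearN -liebC -fE {f fE}.
have [k ->] : exists k, h = (g * k)%g by exists (g^-1 * h)%g; rewrite mulVKg.
have -> : ((g * k)^-1 * g = k^-1)%g by rewrite invgM mulgVK.
rewrite mulKg -Lclass_rel; last by apply: iprep_idealr; exists a.
by rewrite lie_homM iprep_mull //; exists b.
Qed.

Fact Lambda_liebb u : Lambda_lieb u u = 0.
Proof.
move: u; apply: Lambda_ind => [|g a].
  split=> /= [|c x y ux uy]; first by rewrite (bil0l bb).
  rewrite (bilDl bb) !(bilDr bb) !(bilZl bb) !(bilZr bb) ux uy.
  by rewrite [Lambda_lieb y x]Lambda_liebC !scaler0 add0r addr0 scalerN subrr.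
rewrite /= Lambda_lieb_class mulVg iprep1 liebb.
by have [f ->] := Lclass_linear_ex g; rewrite linear0.
Qed.

Fact Lambda_leibniz u v w :
  Lambda_lieb u (Lambda_lieb v w) =
  Lambda_lieb (Lambda_lieb u v) w + Lambda_lieb v (Lambda_lieb u w).
Proof.
move: u; apply: Lambda_ind => [|g a].
  split=> /= [|c x y]; first by rewrite !(bil0l bb) (bil0r bb) addr0.
  rewrite !(bilDl bb, bilDr bb, bilZl bb, bilZr bb).
  by move=> -> ->; rewrite scalerDr addrACA.
move: v; apply: Lambda_ind => [|h b].
  split=> /= [|c x y]; first by rewrite !(bil0l bb) !(bil0r bb) (bil0l bb) addr0.
  rewrite !(bilDl bb, bilDr bb, bilZl bb, bilZr bb).
  by move=> -> ->; rewrite scalerDr addrACA.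
move: w; apply: Lambda_ind => [|k c].
  split=> /= [|c x y]; first by rewrite !(bil0r bb) addr0.
  rewrite !(bilDl bb, bilDr bb, bilZl bb, bilZr bb).
  by move=> -> ->; rewrite scalerDr addrACA.
rewrite /= [Lambda_lieb ⌊h, b⌋[rho] (Lambda_lieb ⌊g, a⌋[rho] _)]Lambda_liebC.
rewrite !Lambda_lieb_class; have [f fE] := Lclass_linear_ex g.
rewrite !fE -linearN -linearD; congr (f _).
rewrite iprep_shift.
by rewrite lieb_leibniz [_ ⋅ (a ⋅ _)]liebC.
Qed.

Fact Lambda_jacobi u v w :
  Lambda_lieb u (Lambda_lieb v w) + Lambda_lieb v (Lambda_lieb w u) +
  Lambda_lieb w (Lambda_lieb u v) = 0.
Proof.
rewrite Lambda_leibniz [Lambda_lieb w (Lambda_lieb u v)]Lambda_liebC.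
by rewrite [Lambda_lieb w u]Lambda_liebC (bilNr bb) addrK addrC addNr.
Qed.

HB.instance Definition _ := Lmodule_isLie.Build K (Lambda rho)
  Lambda_lieb_bilinear Lambda_liebb Lambda_jacobi.

Lemma Lclass_lieb g a h b :
  ⌊g, a⌋[rho] ⋅ ⌊h, b⌋[rho] = ⌊g, a ⋅ rho (g^-1 * h)%g b⌋[rho].
Proof. exact: Lambda_lieb_class. Qed.

End LambdaLie.

Section LambdaAction.
Variables (K : comPzRingType) (G : groupType) (A : lieAlgType K).
Variable rho : ideal_prep G A.

Fact Lambda_act_ex (g : G) : exists f : lie_end (Lambda rho),
  forall h a, f ⌊h, a⌋[rho] = ⌊(g * h)%g, a⌋[rho].
Proof.
have [|h k a ra|F [lF FE]] := @Lambda_univ _ _ _ rho (Lambda rho : lmodType K)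
    (fun h a => ⌊(g * h)%g, a⌋[rho]).
- by move=> h; apply: Lclass_linear.
- by rewrite Lclass_rel // mulgA.
have [F' F'E] := linear_ex lF.
suff FM : {morph F : x y / x ⋅ y} by exists (LieHom lF FM).
move=> u v; move: u; apply: Lambda_ind => [|h a].
  split=> /= [|c x y]; first by rewrite -!F'E lieb0l !linear0 lieb0l.
  by rewrite -!F'E liebDl liebZl !linearP liebDl liebZl => -> ->.
move: v; apply: Lambda_ind => [|k b].
  split=> /= [|c x y]; first by rewrite -!F'E lieb0r !linear0 lieb0r.
  by rewrite -!F'E liebDr liebZr !linearP liebDr liebZr => -> ->.
by rewrite /= !(Lclass_lieb, FE) invgM mulgA mulgVK.
Qed.

Definition Lambda_act (g : G) : lie_end (Lambda rho) :=
  sval (cid (Lambda_act_ex g)).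

Lemma Lambda_actE g h a : Lambda_act g ⌊h, a⌋[rho] = ⌊(g * h)%g, a⌋[rho].
Proof. exact: (svalP (cid (Lambda_act_ex g))). Qed.

Lemma Lambda_lie_end_eq (f1 f2 : lie_end (Lambda rho)) :
  (forall h a, f1 ⌊h, a⌋[rho] = f2 ⌊h, a⌋[rho]) -> f1 = f2.
Proof.
move=> f12; apply: lie_homP; apply: Lambda_ind => [|h a]; last exact: f12.
by apply: linear_eq_submod; apply: lie_hom_linear.
Qed.

Fact Lambda_act1 : (Lambda_act 1 = 1)%g.
Proof. by apply: Lambda_lie_end_eq => h a; rewrite Lambda_actE mul1g. Qed.

Fact Lambda_actM g h : (Lambda_act (g * h) = Lambda_act g * Lambda_act h)%g.
Proof.
apply: Lambda_lie_end_eq => k a.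
by rewrite -[RHS]/(Lambda_act g (Lambda_act h _)) !Lambda_actE mulgA.
Qed.

Definition Lambda_action : global_action G (Lambda rho) :=
  GlobalAction Lambda_act1 Lambda_actM.

End LambdaAction.

Record der_action (K : comPzRingType) (L M : lieAlgType K) := DerAction {
  der_fun :> L -> M -> M;
  der_bilinear : bilinear_map der_fun;
  der_lieb : forall x y m,
    der_fun (x ⋅ y) m = der_fun x (der_fun y m) - der_fun y (der_fun x m);
  derM : forall x m n, der_fun x (m ⋅ n) = der_fun x m ⋅ n + m ⋅ der_fun x n }.

Definition semidirect (K : comPzRingType) (L M : lieAlgType K)
  (act : der_action L M) : Type := (L * M)%type.

Section Semidirect.
Variables (K : comPzRingType) (L M : lieAlgType K) (act : der_action L M).

HB.instance Definition _ := GRing.Lmodule.copy (semidirect act) (L * M)%type.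

Definition semi_lieb (u v : semidirect act) : semidirect act :=
  (u.1 ⋅ v.1, u.2 ⋅ v.2 + act u.1 v.2 - act v.1 u.2).

Let ba := der_bilinear act.

Fact semi_lieb_bilinear : bilinear_map semi_lieb.
Proof.
have eqP' (u v : semidirect act) : u.1 = v.1 -> u.2 = v.2 -> u = v.
  by case: u v => [? ?] [? ?] /= -> ->.
split=> [v c x y|v c x y]; apply: eqP' => /=.
- by rewrite liebDl liebZl.
- rewrite liebDl liebZl (bilDl ba) (bilZl ba) (bilDr ba) (bilZr ba).
  by rewrite !scalerDr scalerN opprD [X in X + _ = _]addrACA [LHS]addrACA.
- by rewrite liebDr liebZr.
- rewrite liebDr liebZr (bilDl ba) (bilZl ba) (bilDr ba) (bilZr ba).
  by rewrite !scalerDr scalerN opprD [X in X + _ = _]addrACA [LHS]addrACA.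
Qed.

Fact semi_liebb u : semi_lieb u u = 0.
Proof. by rewrite /semi_lieb !liebb add0r subrr. Qed.

Let semi_lieb2 (x y z : L) (m n p : M) :
  m ⋅ (n ⋅ p + act y p - act z n) + act x (n ⋅ p + act y p - act z n)
    - act (y ⋅ z) m
  = m ⋅ (n ⋅ p) + (m ⋅ act y p - m ⋅ act z n - p ⋅ act x n + n ⋅ act x p)
    + (act x (act y p) - act x (act z n) - act y (act z m) + act z (act y m)).
Proof.
rewrite !(liebDr, liebNr, bilDr ba, bilNr ba) derM der_lieb.
by rewrite [act x n ⋅ p]liebC opprD opprK !addrA.
Qed.

Let cancel_mixed (V : zmodType) (a b c d e f : V) :
  (a - b - c + d) + (e - d - a + f) + (c - f - e + b) = 0.
Proof.
rewrite !addrA [LHS](ACl ((1*7)*(2*12)*(3*9)*(4*6)*(5*11)*(8*10))) /=.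
by rewrite !subrr !addNr !addr0.
Qed.

Let cancel_pure (V : zmodType) (a b c d e f : V) :
  (a - b - c + d) + (c - e - f + b) + (f - d - a + e) = 0.
Proof.
rewrite !addrA [LHS](ACl ((1*11)*(2*8)*(3*5)*(4*10)*(6*12)*(7*9))) /=.
by rewrite !subrr !addNr !addr0.
Qed.

Let regroup (V : zmodType) (a b c d e f g h i : V) :
  (a + b + c) + (d + e + f) + (g + h + i) =
  (a + d + g) + (b + e + h) + (c + f + i).
Proof. by rewrite !addrA [LHS](ACl (1*4*7*2*5*8*3*6*9)). Qed.

Fact semi_jacobi u v w : semi_lieb u (semi_lieb v w) +
  semi_lieb v (semi_lieb w u) + semi_lieb w (semi_lieb u v) = 0.
Proof.
case: u v w => [x m] [y n] [z p]; rewrite /semi_lieb /=.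
rewrite -[RHS]/(0, 0); congr pair => /=; first exact: lieb_jacobi.
by rewrite !semi_lieb2 regroup lieb_jacobi cancel_mixed cancel_pure !addr0.
Qed.

HB.instance Definition _ := Lmodule_isLie.Build K (semidirect act)
  semi_lieb_bilinear semi_liebb semi_jacobi.

End Semidirect.

Section ProductEndomorphism.
Variables (K : comPzRingType) (L M : lieAlgType K) (act : der_action L M).
Variables (f : lie_end L) (h : lie_end M).
Hypothesis fh : forall x m, h (act x m) = act (f x) (h m).

Definition prod_fun (u : semidirect act) : semidirect act := (f u.1, h u.2).

Fact prod_fun_linear : linear prod_fun.
Proof. by move=> a u v; rewrite /prod_fun /= !linearP. Qed.

Fact prod_funM : {morph prod_fun : u v / u ⋅ v}.
Proof.
move=> u v; rewrite -[LHS]/(f (u.1 ⋅ v.1), h (u.2 ⋅ v.2 + act u.1 v.2 - act v.1 u.2)).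
by rewrite linearB linearD /= !lie_homM !fh.
Qed.

Definition prod_end : lie_end (semidirect act) :=
  LieHom prod_fun_linear prod_funM.

End ProductEndomorphism.

Section Covariant.
Variables (K : comPzRingType) (G : groupType) (L M : lieAlgType K).
Variables (act : der_action L M) (lambda : ideal_prep G L) (pi : ideal_prep G M).

Definition covariant : Prop := forall g x m,
  [/\ pi g (act x m) = act (lambda g x) (pi g m),
      (pi g * pi g^-1)%g (act x m) = act ((lambda g * lambda g^-1)%g x) m
    & act ((lambda g * lambda g^-1)%g x) m = act x ((pi g * pi g^-1)%g m)].

Hypothesis cov : covariant.

Lemma cov_eqv g x m : pi g (act x m) = act (lambda g x) (pi g m).
Proof. by have [] := cov g x m. Qed.

Lemma cov_idemE g x m :
  pi g (pi g^-1%g (act x m)) = act (lambda g (lambda g^-1%g x)) m /\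
  act (lambda g (lambda g^-1%g x)) m = act x (pi g (pi g^-1%g m)).
Proof. by have [] := cov g x m. Qed.

Lemma cov_rngl g x m : range (lambda g) x -> range (pi g) (act x m).
Proof.
move=> rx; have [+ _] := cov_idemE g x m; rewrite (iprep_idem rx) => <-.
by exists (pi g^-1%g (act x m)).
Qed.

Lemma cov_rngr g x m : range (pi g) m -> range (pi g) (act x m).
Proof.
move=> rm; have [e1 e2] := cov_idemE g x m; move: e1.
by rewrite e2 (iprep_idem rm) => <-; exists (pi g^-1%g (act x m)).
Qed.

Lemma cov_idem g x m :
  range (lambda g) x -> act x (pi g (pi g^-1%g m)) = act x m.
Proof. by move=> rx; have [_ <-] := cov_idemE g x m; rewrite (iprep_idem rx). Qed.

Definition prod_prep_fun (g : G) : lie_end (semidirect act) :=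
  prod_end (cov_eqv g).

Fact prod_prepP : partial_rep prod_prep_fun.
Proof.
split=> [|g h|g h]; apply: lie_homP => -[x m].
- by rewrite /= /prod_fun /= !iprep1.
- rewrite -[LHS]/(lambda g^-1%g (lambda g (lambda h x)), pi g^-1%g (pi g (pi h m))).
  by rewrite !iprepVgM.
- rewrite -[LHS]/(lambda g (lambda h (lambda h^-1%g x)), pi g (pi h (pi h^-1%g m))).
  by rewrite !iprepMgV.
Qed.

Fact prod_prep_ideal g : two_sided_ideal (range (prod_prep_fun g)).
Proof.
have rngE (u : semidirect act) : range (prod_prep_fun g) u <->
    range (lambda g) u.1 /\ range (pi g) u.2.
  split=> [[v _ <-]|]; first by split; [exists v.1 | exists v.2].
  by case: u => [x m] /= [[y _ <-] [n _ <-]]; exists (y, n).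
have [sL iL] := iprep_ideal lambda g; have [sM iM] := iprep_ideal pi g.
have MN m : range (pi g) m -> range (pi g) (- m).
  by move=> rm; rewrite -scaleN1r -[_ *: m]addr0; apply: sM.2 => //; exact: sM.1.
have MD m n : range (pi g) m -> range (pi g) n -> range (pi g) (m + n).
  by move=> rm rn; rewrite -[m]scale1r; apply: sM.2.
split.
  split=> [|a u v /rngE [u1 u2] /rngE [v1 v2]]; apply/rngE.
    by split; [exact: sL.1 | exact: sM.1].
  by split; [exact: sL.2 | exact: sM.2].
move=> u v /rngE [v1 v2]; split; apply/rngE; split => /=.
- exact: (iL _ _ v1).1.
- apply: (MD); last by apply: MN; apply: cov_rngl.
  by apply: MD; [exact: (iM _ _ v2).1 | exact: cov_rngr].
- exact: (iL _ _ v1).2.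
- apply: (MD); last by apply: MN; apply: cov_rngr.
  by apply: MD; [exact: (iM _ _ v2).2 | exact: cov_rngl].
Qed.

Definition prod_prep : ideal_prep G (semidirect act) :=
  IdealPrep prod_prepP prod_prep_ideal.

Fact Lambda_der_ex : exists F : Lambda lambda -> Lambda pi -> Lambda pi,
  bilinear_map F /\
  forall g x h m, F ⌊g, x⌋[lambda] ⌊h, m⌋[pi] = ⌊g, act x (pi (g^-1 * h)%g m)⌋[pi].
Proof.
apply: Lambda_pairing.
- exact: der_bilinear.
- exact: cov_eqv.
- exact: cov_rngl.
- exact: cov_idem.
Qed.

Definition Lambda_der_fun := sval (cid Lambda_der_ex).

Lemma Lambda_der_bilinear : bilinear_map Lambda_der_fun.
Proof. exact: (svalP (cid Lambda_der_ex)).1. Qed.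

Lemma Lambda_derE g x h m :
  Lambda_der_fun ⌊g, x⌋[lambda] ⌊h, m⌋[pi] = ⌊g, act x (pi (g^-1 * h)%g m)⌋[pi].
Proof. exact: (svalP (cid Lambda_der_ex)).2. Qed.

Let bd := Lambda_der_bilinear.

Let Lclass_pi_ex g :
  exists f : {linear M -> Lambda pi}, forall a, ⌊g, a⌋[pi] = f a.
Proof. exact: Lclass_linear_ex. Qed.

Let pi_shift g h k x m :
  pi (g^-1 * h)%g (act x (pi (h^-1 * k)%g m)) =
  act (lambda (g^-1 * h)%g x) (pi (g^-1 * k)%g m).
Proof.
rewrite cov_eqv.
have -> : (h^-1 * k = (g^-1 * h)^-1 * (g^-1 * k))%g.
  by rewrite invgM invgK -mulgA mulVKg.
have := iprepVgM pi (g^-1 * h)^-1%g (g^-1 * k)%g m; rewrite invgK => <-.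
by rewrite cov_idem //; exists x.
Qed.

Let Lclass_shift g h y m :
  ⌊h, act y (pi (h^-1 * g)%g m)⌋[pi] = ⌊g, act (lambda (g^-1 * h)%g y) m⌋[pi].
Proof.
have [s ->] : exists s, h = (g * s)%g by exists (g^-1 * h)%g; rewrite mulVKg.
have -> : ((g * s)^-1 * g = s^-1)%g by rewrite invgM mulgVK.
rewrite mulKg -Lclass_rel; last by apply: cov_rngr; exists m.
by rewrite cov_eqv cov_idem //; exists y.
Qed.

Fact Lambda_der_lieb u v w :
  Lambda_der_fun (u ⋅ v) w =
  Lambda_der_fun u (Lambda_der_fun v w) - Lambda_der_fun v (Lambda_der_fun u w).
Proof.
pose bl := (bilDl bd, bilZl bd, bilDr bd, bilZr bd).
pose l := (@liebDl _ (Lambda lambda), @liebDr _ (Lambda lambda),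
           @liebZl _ (Lambda lambda), @liebZr _ (Lambda lambda)).
move: u; apply: Lambda_ind => [|g x].
  split=> /= [|c x y]; first by rewrite lieb0l !(bil0l bd) (bil0r bd) subrr.
  by rewrite !l !bl => -> ->; rewrite opprD -scalerN scalerDr addrACA.
move: v; apply: Lambda_ind => [|h y].
  split=> /= [|c y z]; first by rewrite lieb0r !(bil0l bd) (bil0r bd) subrr.
  by rewrite !l !bl => -> ->; rewrite opprD -scalerN scalerDr addrACA.
move: w; apply: Lambda_ind => [|k m].
  split=> /= [|c m n]; first by rewrite !(bil0r bd) subrr.
  by rewrite !bl => -> ->; rewrite opprD -scalerN scalerDr addrACA.
rewrite /= Lclass_lieb !Lambda_derE pi_shift (Lclass_shift g h).
by have [f fE] := Lclass_pi_ex g; rewrite !fE -linearB -der_lieb.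
Qed.

Fact Lambda_derM u v w :
  Lambda_der_fun u (v ⋅ w) = Lambda_der_fun u v ⋅ w + v ⋅ Lambda_der_fun u w.
Proof.
pose bl := (bilDl bd, bilZl bd, bilDr bd, bilZr bd).
pose l := (@liebDl _ (Lambda pi), @liebDr _ (Lambda pi),
           @liebZl _ (Lambda pi), @liebZr _ (Lambda pi)).
move: u; apply: Lambda_ind => [|g x].
  split=> /= [|c x y]; first by rewrite !(bil0l bd) lieb0l lieb0r addr0.
  by rewrite !bl !l => -> ->; rewrite scalerDr addrACA.
move: v; apply: Lambda_ind => [|h m].
  split=> /= [|c m n]; first by rewrite lieb0l !(bil0r bd) !lieb0l addr0.
  by rewrite ?(l, bl) => -> ->; rewrite scalerDr addrACA.
move: w; apply: Lambda_ind => [|k n].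
  split=> /= [|c m' n]; first by rewrite lieb0r !(bil0r bd) !lieb0r addr0.
  by rewrite ?(l, bl) => -> ->; rewrite scalerDr addrACA.
rewrite /= [⌊h, m⌋[pi] ⋅ Lambda_der_fun _ _]liebC !(Lclass_lieb, Lambda_derE).
have [f fE] := Lclass_pi_ex g; rewrite !fE iprep_shift -linearB.
by rewrite derM [_ ⋅ act _ _]liebC.
Qed.

Definition Lambda_der : der_action (Lambda lambda) (Lambda pi) :=
  DerAction Lambda_der_bilinear Lambda_der_lieb Lambda_derM.

Fact Lambda_der_eqv g u v :
  Lambda_action pi g (Lambda_der u v) =
  Lambda_der (Lambda_action lambda g u) (Lambda_action pi g v).
Proof.
rewrite /=; move: u; apply: Lambda_ind => [|h x].
  split=> /= [|c x y]; first by rewrite linear0 !(bil0l bd) linear0.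
  by rewrite !(bilDl bd, bilZl bd, linearP) /= => -> ->.
move: v; apply: Lambda_ind => [|k m].
  split=> /= [|c m n]; first by rewrite linear0 !(bil0r bd) linear0.
  by rewrite !(bilDr bd, bilZr bd, linearP) /= => -> ->.
by rewrite /= !(Lambda_actE, Lambda_derE) invgM mulgA mulgVK.
Qed.

End Covariant.

Section ProductAction.
Variables (K : comPzRingType) (G : groupType) (L M : lieAlgType K).
Variables (act : der_action L M) (alpha : global_action G L) (beta : global_action G M).
Hypothesis act_eqv : forall g x m, beta g (act x m) = act (alpha g x) (beta g m).

Definition prod_action_fun (g : G) : lie_end (semidirect act) :=
  prod_end (act_eqv g).

Fact prod_action1 : (prod_action_fun 1 = 1)%g.
Proof.
by apply: lie_homP => -[x m]; rewrite /= /prod_fun /= !gact1.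
Qed.

Fact prod_actionM g h :
  (prod_action_fun (g * h) = prod_action_fun g * prod_action_fun h)%g.
Proof.
by apply: lie_homP => -[x m]; rewrite /= /prod_fun /= !gactM.
Qed.

Definition prod_action : global_action G (semidirect act) :=
  GlobalAction prod_action1 prod_actionM.

End ProductAction.

(* Main.v *)
Require Import Defs.
From mathcomp Require Import all_boot all_order all_algebra.

(** The construction Lambda is functorial for K-linear maps that intertwine two
    ideal partial representations ([Lambda_map]): such a map sends ranges to
    ranges, so it respects the defining relations.  The underlying module of
    the semidirect product is a direct sum whose two projections and two
    inclusions all intertwine [prod_prep cov] with [lambda] and [pi].  Lambda
    therefore carries it to a direct sum: the maps induced by the projections
    give a linear map from Lambda of the semidirect product to the semidirect
    product of the Lambdas, and those induced by the inclusions give its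
    inverse.

    The classes span ([Lambda_linear_eq]), so it remains to compare products of
    two classes.  All terms match at once except the one in which the second
    factor acts on the first: the product taken in Lambda of the semidirect product is a class
    based at the group element g of the first factor, while the action of
    Lambda [lambda] on Lambda [pi] gives a class based at that of the second.
    Covariance makes the two agree ([Lclass_der_shift]).

    Equivariance is clear, as both actions translate the group element of a
    class. *)

Set Implicit Arguments.
Unset Strict Implicit.
Unset Printing Implicit Defensive.

Import GRing.Theory.
Local Open Scope ring_scope.

(** The intertwining maps are only required to be linear because the inclusions
    and projections of a semidirect product have to be treated alike, and the
    projection to the ideal [M] need not be multiplicative. *)
Lemma Lambda_map (K : comPzRingType) (G : groupType) (A B : lieAlgType K)
    (rho : ideal_prep G A) (sigma : ideal_prep G B) (f : A -> B) :
    linear f -> (forall g a, f (rho g a) = sigma g (f a)) ->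
  exists F : {linear Lambda rho -> Lambda sigma},
    forall g a, F ⌊g, a⌋[rho] = ⌊g, f a⌋[sigma].
Proof.
move=> lf fE.
have [|g h a [b _ <-]|F [lF FE]] := @Lambda_univ _ _ _ rho
    (Lambda sigma : lmodType K) (fun g a => ⌊g, f a⌋[sigma]).
- by move=> g c x y; rewrite lf Lclass_linear.
- by rewrite fE Lclass_rel // fE; exists (f b).
- by have [F' F'F] := linear_ex lF; exists F' => g a; rewrite F'F.
Qed.

Lemma Lambda_linear_eq (K : comPzRingType) (G : groupType) (A : lieAlgType K)
    (rho : ideal_prep G A) (N : lmodType K) (f1 f2 : {linear Lambda rho -> N}) :
  (forall g a, f1 ⌊g, a⌋[rho] = f2 ⌊g, a⌋[rho]) -> f1 =1 f2.
Proof.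
by move=> f12; apply: Lambda_ind f12; apply: linear_eq_submod; apply: linearP.
Qed.

Section SemidirectLambda.
Variables (K : comPzRingType) (G : groupType) (L M : lieAlgType K).
Variables (act : der_action L M) (lambda : ideal_prep G L) (pi : ideal_prep G M).
Hypothesis cov : covariant act lambda pi.

(** The element at base point [h] lies in the range of
    [pi (h^-1 * g)], so the class may be moved to base point [g] by applying
    [pi (g^-1 * h)].  By covariance this turns [y] into [lambda (g^-1 * h) y]
    and [m] into its image under the idempotent of [g^-1 * h], and elements in
    the range of [lambda (g^-1 * h)] act on [m] and on that image alike. *)
Lemma Lclass_der_shift g h y m :
  ⌊h, act y (pi (h^-1 * g)%g m)⌋[pi] = ⌊g, act (lambda (g^-1 * h)%g y) m⌋[pi].
Proof.
have [s ->] : exists s, h = (g * s)%g by exists (g^-1 * h)%g; rewrite mulVKg.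
have -> : ((g * s)^-1 * g = s^-1)%g by rewrite invgM mulgVK.
rewrite mulKg -Lclass_rel; last by apply: (cov_rngr cov); exists m.
by rewrite (cov_eqv cov) (cov_idem cov) //; exists y.
Qed.

Let S := semidirect act.
Let LS := Lambda (prod_prep cov).
Let SL := semidirect (Lambda_der cov).

Lemma Lambda_semidirect_linear_iso :
  exists (F : {linear LS -> SL}) (H : {linear SL -> LS}),
  [/\ cancel F H, cancel H F &
      forall g x m, F ⌊g, (x, m) : S⌋[prod_prep cov]
        = (⌊g, x⌋[lambda], ⌊g, m⌋[pi])].
Proof.
have [P PE] := @Lambda_map _ _ _ _ (prod_prep cov) lambda fst
  (fun _ _ _ => erefl) (fun _ _ => erefl).
have [Q QE] := @Lambda_map _ _ _ _ (prod_prep cov) pi snd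
  (fun _ _ _ => erefl) (fun _ _ => erefl).
have [|g x|I IE] := @Lambda_map _ _ _ _ lambda (prod_prep cov) (fun x => (x, 0)).
- by move=> c x y; congr pair; rewrite /= scaler0 addr0.
- by congr pair; rewrite /= linear0.
have [|g x|J JE] := @Lambda_map _ _ _ _ pi (prod_prep cov) (fun m => (0, m)).
- by move=> c x y; congr pair; rewrite /= scaler0 addr0.
- by congr pair; rewrite /= linear0.
have [|F FE] := @linear_ex K LS SL (fun u => (P u, Q u)).
  by move=> c u v; rewrite !linearP.
have [|H HE] := @linear_ex K SL LS (fun w => I w.1 + J w.2).
  by move=> c u v; rewrite /= !linearP scalerDr addrACA.
have PI : P \o I =1 idfun by apply: Lambda_linear_eq => g x /=; rewrite IE PE.
have QJ : Q \o J =1 idfun by apply: Lambda_linear_eq => g m /=; rewrite JE QE.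
have PJ : P \o J =1 \0.
  apply: Lambda_linear_eq => g m /=; rewrite JE PE /=.
  by have [f ->] := Lclass_linear_ex lambda g; rewrite linear0.
have QI : Q \o I =1 \0.
  apply: Lambda_linear_eq => g x /=; rewrite IE QE /=.
  by have [f ->] := Lclass_linear_ex pi g; rewrite linear0.
have HF : H \o F =1 idfun.
  apply: Lambda_linear_eq => g [x m] /=; rewrite FE HE /= PE QE IE JE.
  have [f fE] := Lclass_linear_ex (prod_prep cov) g.
  by rewrite !fE -linearD; congr (f (_, _)); [exact: addr0 | exact: add0r].
exists F, H; split=> [|[u v]|g x m]; first exact: HF.
- rewrite FE HE /= !linearD; congr pair.
    by rewrite -[RHS]addr0; congr (_ + _); [exact: PI | exact: PJ].
  by rewrite -[RHS]add0r; congr (_ + _); [exact: QI | exact: QJ].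
- by rewrite FE PE QE.
Qed.

Lemma Lambda_semidirect_mul (F : {linear LS -> SL}) :
    (forall g x m, F ⌊g, (x, m) : S⌋[prod_prep cov]
      = (⌊g, x⌋[lambda], ⌊g, m⌋[pi])) ->
  {morph F : u v / u ⋅ v}.
Proof.
move=> FE u v; move: u; apply: Lambda_ind => [|g [x m]].
  split=> /= [|c w z]; first by rewrite lieb0l !linear0 lieb0l.
  by rewrite liebDl liebZl !linearP liebDl liebZl => -> ->.
move: v; apply: Lambda_ind => [|h [y n]].
  split=> /= [|c w z]; first by rewrite lieb0r !linear0 lieb0r.
  by rewrite liebDr liebZr !linearP liebDr liebZr => -> ->.
rewrite /= Lclass_lieb !FE.
(* The term in which [y] acts on [m] is based at [h], all others at [g]. *)
rewrite -[RHS]/(_ ⋅ _, _ ⋅ _ + Lambda_der cov _ _ - Lambda_der cov _ _) /=.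
rewrite !Lclass_lieb !(Lambda_derE cov) (Lclass_der_shift g h).
by have [f fE] := Lclass_linear_ex pi g; rewrite !fE -linearD -linearB.
Qed.

End SemidirectLambda.

Theorem theorem4p2 (K : comPzRingType) (G : groupType) (L M : lieAlgType K)
    (act : der_action L M) (lambda : ideal_prep G L) (pi : ideal_prep G M)
    (cov : covariant act lambda pi) :
  action_iso (Lambda_action (prod_prep cov)) (prod_action (Lambda_der_eqv cov)) /\
  lie_iso (Lambda (prod_prep cov)) (semidirect (Lambda_der cov)).
Proof.
have [F [H [FK HK FE]]] := Lambda_semidirect_linear_iso cov.
pose f := LieHom (linearP F) (Lambda_semidirect_mul FE).
have bij_f : bijective f by exists H.
split; last by exists f.
exists f; split=> // g; pose b := prod_action (Lambda_der_eqv cov) g.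
suff Feq : F \o Lambda_act (prod_prep cov) g =1 b \o F by exact: Feq.
apply: Lambda_linear_eq => h [x m] /=; rewrite Lambda_actE !FE.
by congr pair; rewrite /= Lambda_actE.
Qed.
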